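(* Let $\mathbb{F}$ be a commutative field of characteristic $0$. If $x,y \in \mathbb{R}^2$ and $|x-y|^2$ is a rational number, then there exists a finite set $S_{xy}$ with $\{x,y\} \subseteq S_{xy} \subseteq \mathbb{R}^2$ such that any map $f:S_{xy}\to \mathbb{F}^2$ that preserves unit distance also preserves the distance between $x$ and $y$, i.e. satisfies $\varphi_2(f(x),f(y))=|x-y|^2$.
   Context: For $u=(u_1,u_2)$, $v=(v_1,v_2)\in\mathbb{F}^2$, $\varphi_2(u,v)=(u_1-v_1)^2+(u_2-v_2)^2\in\mathbb{F}$. For $S\subseteq\mathbb{R}^2$, a map $f:S\to\mathbb{F}^2$ preserves unit distance if for all $p,q\in S$, $|p-q|=1$ (Euclidean distance) implies $\varphi_2(f(p),f(q))=1$. Rational numbers are regarded as elements of $\mathbb{F}$ via the canonical embedding $\mathbb{Q}\subseteq\mathbb{F}$. *)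

(* Defs.v *)
From HB Require Import structures.
From mathcomp Require Import all_boot all_order all_algebra.
From mathcomp Require Import boolp classical_sets cardinality reals.

Set Implicit Arguments.
Unset Strict Implicit.
Unset Printing Implicit Defensive.

Import Order.TTheory GRing.Theory Num.Theory.

Local Open Scope ring_scope.
Local Open Scope classical_set_scope.

(* Points of the plane over a ring K are row vectors; u 0 0 and u 0 1 are the
   first and second coordinates. *)
Definition phi2 (K : pzRingType) (u v : 'rV[K]_2) : K :=
  (u 0 0 - v 0 0) ^+ 2 + (u 0 1 - v 0 1) ^+ 2.

(* The Euclidean norm of x - y; the library norm on 'rV[R]_2 is the sup norm. *)
Definition edist (R : realType) (x y : 'rV[R]_2) : R := Num.sqrt (phi2 x y).

(* A set S is coerced to the subtype {p | p \in S}, so f is defined on S only. *)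
Definition preserves_unit_distance (R : realType) (F : fieldType)
    (S : set 'rV[R]_2) (f : S -> 'rV[F]_2) : Prop :=
  forall p q : S, edist (val p) (val q) = 1 -> phi2 (f p) (f q) = 1.

(* Main.v *)
Require Import Defs.
From HB Require Import structures.
From mathcomp Require Import all_boot all_order all_algebra.
From mathcomp Require Import boolp classical_sets cardinality reals.
From mathcomp Require Import filter ring lra.

Set Implicit Arguments.
Unset Strict Implicit.
Unset Printing Implicit Defensive.

Import Order.TTheory GRing.Theory Num.Theory.

Local Open Scope ring_scope.
Local Open Scope classical_set_scope.

(** A squared distance [r] is forced when any two points of the real plane at
squared distance [r] belong to a finite configuration whose unit distances
determine, under every unit-preserving map [f] to [F^2], that the images of the
two points are at squared distance [r] too. The theorem says that every
rational [r >= 0] is forced. Distances in [F^2] are not anisotropic in general,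
so each step has to avoid dividing by a squared length that could vanish; it
suffices that only nonzero rational ones are ever inverted.

Three closure properties carry the proof.

- Rhombi ([forced_dist_rhombus]). Take a rhombus with squared side [a], whose
  diagonals have squared lengths [b] and [4a - b]. In [F^2] the two ends of the
  second diagonal are both equidistant from the ends of the first one, so they
  either coincide or satisfy the parallelogram law, which gives [4a - b]
  ([rhombus_diagonals]). Coincidence is excluded as in the Moser spindle:
  rotate the second diagonal about one end until the other end has moved by
  a forced squared distance [c] different from [0] and [4a - b].

- Lines ([collinear]). A point of [F^2] whose distances to two points [o] and
  [u] are those of [o + k (u - o)] is that point, provided that [o] and [u] are
  not at squared distance [0]. From [1], the rhombus rule gives [3], two
  adjacent unit rhombi give [4], and induction along a line gives all [n^2].

- Division ([forced_dist_divide]). If [n^2 d] is forced then so is [d]: join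
  two points at squared distance [d] to a point [z] at a large integer distance
  from both, and apply the homothety of centre [z] and ratio [n]; it is
  respected by [f] because it takes place on two lines with integer distances.

Hence the squares of the positive rationals are forced. For a rational [r > 0]
other than [1], the rhombus rule with [a = ((r + 1) / 4)^2] and
[b = ((r - 1) / 2)^2] then forces [4a - b = r], a small rational square serving
as [c]. *)

(** * The quadratic form on the plane *)

Lemma row2P (K : pzRingType) (u v : 'rV[K]_2) :
  u 0 0 = v 0 0 -> u 0 1 = v 0 1 -> u = v.
Proof.
move=> uv0 uv1; apply/rowP => i.
case: (unliftP 0 i) => [j|] -> //; rewrite ord1 (_ : lift _ _ = 1) //.
exact: val_inj.
Qed.

Lemma phi2C (K : comPzRingType) (u v : 'rV[K]_2) : phi2 u v = phi2 v u.
Proof. by rewrite /phi2; ring. Qed.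

Lemma phi2xx (K : pzRingType) (u : 'rV[K]_2) : phi2 u u = 0.
Proof. by rewrite /phi2 !subrr expr0n addr0. Qed.

Lemma phi2_eq0 (R : realType) (u v : 'rV[R]_2) : phi2 u v = 0 -> u = v.
Proof.
move/eqP; rewrite paddr_eq0 ?sqr_ge0 // !sqrf_eq0 !subr_eq0.
by case/andP => /eqP ? /eqP ?; exact: row2P.
Qed.

Lemma edist1E (R : realType) (u v : 'rV[R]_2) : edist u v = 1 <-> phi2 u v = 1.
Proof.
have uv0 : 0 <= phi2 u v by rewrite addr_ge0 ?sqr_ge0.
rewrite /edist; split => [uv1|->]; last exact: sqrtr1.
by rewrite -(sqr_sqrtr uv0) uv1 expr1n.
Qed.

Lemma phi2_line (K : comPzRingType) (u v : 'rV[K]_2) (k l : K) :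
  phi2 (u + k *: (v - u)) (u + l *: (v - u)) = (k - l) ^+ 2 * phi2 u v.
Proof. by rewrite /phi2 !mxE; ring. Qed.

Lemma phi2_line0 (K : comPzRingType) (u v : 'rV[K]_2) (k : K) :
  phi2 u (u + k *: (v - u)) = k ^+ 2 * phi2 u v.
Proof. by rewrite /phi2 !mxE; ring. Qed.

Lemma phi2_line1 (K : comPzRingType) (u v : 'rV[K]_2) (k : K) :
  phi2 (u + k *: (v - u)) v = (1 - k) ^+ 2 * phi2 u v.
Proof. by rewrite /phi2 !mxE; ring. Qed.

Lemma phi2_homothety (K : comPzRingType) (o u v : 'rV[K]_2) (k : K) :
  phi2 (o + k *: (u - o)) (o + k *: (v - o)) = k ^+ 2 * phi2 u v.
Proof. by rewrite /phi2 !mxE; ring. Qed.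

Lemma parallelogram_law (K : comPzRingType) (u v a b : 'rV[K]_2) :
  u + v = a + b -> phi2 u v + phi2 a b = 2 * (phi2 u a + phi2 v a).
Proof.
move=> uvab; have {uvab}-> : b = u + v - a by rewrite uvab addrC addKr.
by rewrite /phi2 !mxE; ring.
Qed.

(** By Heron's formula, the second hypothesis says that the triangle with squared
sides [s], [t] and [phi2 x y] has a nonnegative squared area. *)
Lemma circles_meet (R : realType) (x y : 'rV[R]_2) (s t : R) :
  0 < phi2 x y -> (s + phi2 x y - t) ^+ 2 <= 4 * s * phi2 x y ->
  exists z, phi2 x z = s /\ phi2 y z = t.
Proof.
set e := phi2 x y => e0 triangle.
(* The coordinates of z in the orthogonal frame y - x, J (y - x) at x. *)
pose al := (s + e - t) / (2 * e).
pose be := Num.sqrt (s / e - al ^+ 2).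
have be2 : be ^+ 2 = s / e - al ^+ 2.
  rewrite sqr_sqrtr // subr_ge0 /al expr_div_n.
  rewrite ler_pdivrMr ?exprn_gt0 ?mulr_gt0 //.
  by have -> : s / e * (2 * e) ^+ 2 = 4 * s * e by field; rewrite gt_eqF.
pose z : 'rV[R]_2 := \row_i
  (if i == 0 then x 0 0 + al * (y 0 0 - x 0 0) - be * (y 0 1 - x 0 1)
   else x 0 1 + al * (y 0 1 - x 0 1) + be * (y 0 0 - x 0 0)).
have xz : phi2 x z = (al ^+ 2 + be ^+ 2) * e by rewrite /e /phi2 !mxE /=; ring.
have yz : phi2 y z = ((1 - al) ^+ 2 + be ^+ 2) * e.
  by rewrite /e /phi2 !mxE /=; ring.
exists z; rewrite xz yz be2 /al; split; field; by rewrite gt_eqF.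
Qed.

(** A vector [w] orthogonal to [d] is a multiple of the quarter turn of [d]; the
identities are kept free of divisions, and the last one is Lagrange's. *)
Lemma orthogonal_to (K : comPzRingType) (w0 w1 d0 d1 : K) :
  w0 * d0 + w1 * d1 = 0 ->
  let m := w1 * d0 - w0 * d1 in
  [/\ (d0 ^+ 2 + d1 ^+ 2) * w0 = - d1 * m, (d0 ^+ 2 + d1 ^+ 2) * w1 = d0 * m
    & (w0 ^+ 2 + w1 ^+ 2) * (d0 ^+ 2 + d1 ^+ 2) = m ^+ 2].
Proof.
move=> wd m; split; apply/eqP; rewrite -subr_eq0; apply/eqP.
- transitivity (d0 * (w0 * d0 + w1 * d1)); first by rewrite /m; ring.
  by rewrite wd mulr0.
- transitivity (d1 * (w0 * d0 + w1 * d1)); first by rewrite /m; ring.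
  by rewrite wd mulr0.
- transitivity ((w0 * d0 + w1 * d1) ^+ 2); first by rewrite /m; ring.
  by rewrite wd expr0n.
Qed.

(** Both [u] and [v] lie on the perpendicular bisector of [a] and [b], at the
same squared distance from the midpoint. The bisector is directed by a
non-isotropic vector, so [u] and [v] are equal or symmetric about the
midpoint. *)
Lemma rhombus_diagonals (K : fieldType) (u v a b : 'rV[K]_2) (s : K) :
  (2 : K) != 0 -> phi2 a b != 0 ->
  phi2 u a = s -> phi2 u b = s -> phi2 v a = s -> phi2 v b = s ->
  u = v \/ u + v = a + b.
Proof.
move=> two0 ab0 ua ub va vb.
pose d0 := b 0 0 - a 0 0; pose d1 := b 0 1 - a 0 1.
have dd : phi2 a b = d0 ^+ 2 + d1 ^+ 2 by rewrite /phi2 /d0 /d1; ring.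
(* Twice the vector from the midpoint of a and b to z. *)
pose w (z : 'rV[K]_2) i := 2 * z 0 i - (a 0 i + b 0 i).
have w_orth z : phi2 z a = s -> phi2 z b = s -> w z 0 * d0 + w z 1 * d1 = 0.
  move=> za zb; transitivity (phi2 z a - phi2 z b); last by rewrite za zb subrr.
  by rewrite /w /d0 /d1 /phi2; ring.
have w_norm z : phi2 z a = s -> phi2 z b = s ->
    w z 0 ^+ 2 + w z 1 ^+ 2 = 4 * s - phi2 a b.
  move=> za zb; transitivity (2 * (phi2 z a + phi2 z b) - phi2 a b).
    by rewrite /w /phi2; ring.
  by rewrite za zb; ring.
have [u0 u1 uu] := orthogonal_to (w_orth u ua ub).
have [v0 v1 vv] := orthogonal_to (w_orth v va vb).
rewrite !w_norm // -!dd in u0 u1 uu v0 v1 vv.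
move/eqP: vv; rewrite uu eqf_sqr => /orP [] /eqP uv; [left|right].
  have eq_w i : phi2 a b * w u i = phi2 a b * w v i -> u 0 i = v 0 i.
    by move/(mulfI ab0)/addIr/(mulfI two0).
  by apply: row2P; apply: eq_w; rewrite ?u0 ?u1 uv ?v0 ?v1.
have opp_w i : phi2 a b * w u i = - (phi2 a b * w v i) ->
    (u + v) 0 i = (a + b) 0 i.
  rewrite -mulrN => /(mulfI ab0) uvi; rewrite !mxE; apply: (mulfI two0).
  apply/eqP; rewrite -subr_eq0 -(subrr (w u i)) {2}uvi /w; apply/eqP; ring.
by apply: row2P; apply: opp_w; rewrite ?u0 ?u1 uv ?v0 ?v1; ring.
Qed.

(** The error vector [h = v - (o + k (u - o))] is orthogonal to [u - o] and
isotropic. A vector orthogonal to a non-isotropic one in the plane is a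
multiple of its quarter turn, hence vanishes when it is isotropic. *)
Lemma collinear (K : fieldType) (o u v : 'rV[K]_2) (k : K) :
  (2 : K) != 0 -> phi2 o u != 0 ->
  phi2 o v = k ^+ 2 * phi2 o u -> phi2 v u = (1 - k) ^+ 2 * phi2 o u ->
  v = o + k *: (u - o).
Proof.
move=> two0 ou0 ov vu.
pose d0 := u 0 0 - o 0 0; pose d1 := u 0 1 - o 0 1.
pose h i := v 0 i - (o 0 i + k * (u 0 i - o 0 i)).
have dd : phi2 o u = d0 ^+ 2 + d1 ^+ 2 by rewrite /phi2 /d0 /d1; ring.
have hd : h 0 * d0 + h 1 * d1 = 0.
  apply: (mulfI two0); rewrite mulr0.
  transitivity (phi2 o v + (1 - 2 * k) * phi2 o u - phi2 v u).
    by rewrite /h /d0 /d1 /phi2; ring.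
  by rewrite ov vu; ring.
have hh : h 0 ^+ 2 + h 1 ^+ 2 = 0.
  transitivity (phi2 o v - k ^+ 2 * phi2 o u
                - 2 * k * (h 0 * d0 + h 1 * d1)).
    by rewrite /h /d0 /d1 /phi2; ring.
  by rewrite ov hd; ring.
have [h0 h1 /esym/eqP] := orthogonal_to hd.
rewrite hh mul0r sqrf_eq0 => /eqP m0; rewrite -dd m0 !mulr0 in h0 h1.
have eq_h i : phi2 o u * h i = 0 -> v 0 i = (o + k *: (u - o)) 0 i.
  move/eqP; rewrite mulf_eq0 (negPf ou0) subr_eq0 => /eqP ->.
  by rewrite !mxE.
by apply: row2P; apply: eq_h.
Qed.

(** * Configurations that force a property *)

Section ForcedDistances.
(* Every ring morphism from the rationals is the canonical embedding; as a
   variable it stands for the hypothesis that F has characteristic 0. *)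
Variables (R : realType) (F : fieldType) (iota : {rmorphism rat -> F}).

Definition unit_on (s : seq 'rV[R]_2) (f : 'rV[R]_2 -> 'rV[F]_2) :=
  {in s &, forall p q, phi2 p q = 1 -> phi2 (f p) (f q) = 1}.

(** Working with total maps and with the filter of the properties implied by the
unit distances of some finite configuration makes configurations implicit:
the union of finitely many of them is the intersection property of the
filter. *)
Definition forced : set_system ('rV[R]_2 -> 'rV[F]_2) :=
  [set P | exists s, unit_on s `<=` P].

Local Instance forced_filter : Filter forced.
Proof.
split; first by exists [::].
- move=> P Q [s sP] [t tQ]; exists (s ++ t) => f f1; split.
    by apply: sP => p q ps qs; apply: f1; rewrite mem_cat ?ps ?qs.
  by apply: tQ => p q pt qt; apply: f1; rewrite mem_cat ?pt ?qt orbT.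
- by move=> P Q PQ [s sP]; exists s; exact: subset_trans PQ.
Qed.

Definition forced_dist (r : rat) := forall x y : 'rV[R]_2,
  phi2 x y = ratr r -> \forall f \near forced, phi2 (f x) (f y) = iota r.

Let iota_eq0 r : (iota r == 0) = (r == 0).
Proof. exact: fmorph_eq0. Qed.

Let two_neq0 : (2 : F) != 0.
Proof. by rewrite -(rmorph_nat iota) iota_eq0. Qed.

Lemma forced_dist0 : forced_dist 0.
Proof.
move=> x y; rewrite rmorph0 => /phi2_eq0 <-.
by apply: nearW => f; rewrite phi2xx rmorph0.
Qed.

Lemma forced_dist1 : forced_dist 1.
Proof.
move=> x y xy; exists [:: x; y] => f f1; rewrite rmorph1.
by apply: f1; rewrite ?inE ?eqxx ?orbT // xy rmorph1.
Qed.

(** * Closure properties of the forced distances *)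

(** The squared length [c] is that of the motion that separates the ends of the
diagonal: were the images of [x] and [y] equal, those of [y] and [z] would be at
squared distance [0] or [4a - b] as well as [c]. *)
Lemma forced_dist_rhombus (a b c : rat) :
  forced_dist a -> forced_dist b -> forced_dist c ->
  0 < b < 4 * a -> 0 < c <= 4 * (4 * a - b) -> c != 4 * a - b ->
  forced_dist (4 * a - b).
Proof.
set e := 4 * a - b => Da Db Dc /andP [b0 b4a] /andP [c0 ce] c_neq_e.
have e0 : 0 < e by rewrite /e; lra.
have Re0 : (0 : R) < ratr e by rewrite ltr0q.
(* The rhombus alone leaves open the collapse f x = f y. *)
have dichotomy x y : phi2 x y = ratr e ->
    \forall f \near forced, f x = f y \/ phi2 (f x) (f y) = iota e.
  move=> xy.
  have [||u [xu yu]] := @circles_meet R x y (ratr a) (ratr a).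
  - by rewrite xy.
  - have -> : ratr a + phi2 x y - ratr a = ratr e by rewrite xy; ring.
    rewrite xy expr2 ler_pM2r //.
    have -> : 4 * ratr a = ratr (4 * a) :> R by rewrite rmorphM /= ratr_nat.
    by rewrite ler_rat /e; lra.
  pose v := x + y - u.
  have uvE : x + y = u + v by rewrite /v addrCA subrr addr0.
  have xv : phi2 x v = ratr a by rewrite -yu /phi2 /v !mxE; ring.
  have yv : phi2 y v = ratr a by rewrite -xu /phi2 /v !mxE; ring.
  have uv : phi2 u v = ratr b.
    have := parallelogram_law uvE; rewrite xy xu yu => uvb.
    have -> : phi2 u v = 2 * (ratr a + ratr a) - ratr e by rewrite -uvb; ring.
    by rewrite /e; ring.
  near=> f.
  have fxu : phi2 (f x) (f u) = iota a by near: f; exact: Da.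
  have fxv : phi2 (f x) (f v) = iota a by near: f; exact: Da.
  have fyu : phi2 (f y) (f u) = iota a by near: f; exact: Da.
  have fyv : phi2 (f y) (f v) = iota a by near: f; exact: Da.
  have fuv : phi2 (f u) (f v) = iota b by near: f; exact: Db.
  have fuv0 : phi2 (f u) (f v) != 0 by rewrite fuv iota_eq0 gt_eqF.
  have [|fE] := rhombus_diagonals two_neq0 fuv0 fxu fxv fyu fyv; first by left.
  right.
  have := parallelogram_law fE; rewrite fxu fyu fuv => fxyE.
  have -> : phi2 (f x) (f y) = 2 * (iota a + iota a) - iota b.
    by rewrite -fxyE; ring.
  by rewrite /e; ring.
move=> x y xy.
have [||z [xz yz]] := @circles_meet R x y (ratr e) (ratr c).
- by rewrite xy.
- rewrite xy.
  have -> : (ratr e + ratr e - ratr c) ^+ 2 = ratr ((e + e - c) ^+ 2) :> R.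
    by ring.
  have -> : 4 * ratr e * ratr e = ratr (4 * e * e) :> R by ring.
  rewrite ler_rat; nra.
near=> f.
have [fxy|//] : f x = f y \/ phi2 (f x) (f y) = iota e.
  by near: f; exact: dichotomy.
have fyz : phi2 (f y) (f z) = iota c by near: f; exact: Dc.
have [fxz|] : f x = f z \/ phi2 (f x) (f z) = iota e.
    by near: f; exact: dichotomy.
  move: fyz; rewrite -fxy fxz phi2xx => /esym/eqP; rewrite iota_eq0.
  by rewrite gt_eqF.
by rewrite fxy fyz => /fmorph_inj ce'; rewrite ce' eqxx in c_neq_e.
Unshelve. all: by end_near. Qed.

Lemma forced_dist3 : forced_dist 3.
Proof.
rewrite (_ : 3 = 4 * 1 - 1) //.
by apply: (forced_dist_rhombus _ _ forced_dist1) => //; exact: forced_dist1.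
Qed.

(** With [m] the midpoint of [x] and [y], the triangular lattice gives unit
rhombi [x a b m] and [y b a m], which together express [f y] as the reflection
of [f x] through [f m]. The rhombus rule cannot reach [4] from [1] and [3], since
[4a - b] is odd when [b] is. *)
Lemma forced_dist4 : forced_dist 4.
Proof.
move=> x y; rewrite ratr_nat => xy.
pose m := x + 2^-1 *: (y - x).
have xm : phi2 x m = 1 by rewrite phi2_line0 xy; field.
have [||a [xa ma]] := @circles_meet R x m 1 1; rewrite ?xm //; first by lra.
pose b := a + m - x.
have yE : y = 2 *: m - x.
  by apply/rowP => i; rewrite /m !mxE; field.
have bm : phi2 b m = 1 by rewrite -xa /phi2 /b !mxE; ring.
have ba : phi2 b a = 1 by rewrite -xm /phi2 /b !mxE; ring.
have yb : phi2 y b = 1 by rewrite -ma yE /phi2 /b !mxE; ring.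
have ym : phi2 y m = 1 by rewrite -xm yE /phi2 !mxE; ring.
have am := etrans (phi2C a m) ma.
have xb : phi2 x b = 3.
  have E : x + b = a + m by rewrite /b addrC subrK.
  by have := parallelogram_law E; rewrite am xa ba => E'; lra.
have ya : phi2 y a = 3.
  have E : y + a = b + m.
    by apply/rowP => i; rewrite yE /b !mxE; ring.
  by have := parallelogram_law E; rewrite bm yb (phi2C a) ba => E'; lra.
have one p q : phi2 p q = 1 -> \forall f \near forced, phi2 (f p) (f q) = 1.
  by move=> pq; rewrite -(rmorph1 iota); apply: forced_dist1; rewrite rmorph1.
have three p q : phi2 p q = 3 -> \forall f \near forced, phi2 (f p) (f q) = 3.
  move=> pq; rewrite -(rmorph_nat iota).
  by apply: forced_dist3; rewrite ratr_nat.
near=> f.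
have fxa : phi2 (f x) (f a) = 1 by near: f; exact: one.
have fxm : phi2 (f x) (f m) = 1 by near: f; exact: one.
have fam : phi2 (f a) (f m) = 1 by near: f; exact: one.
have fba : phi2 (f b) (f a) = 1 by near: f; exact: one.
have fbm : phi2 (f b) (f m) = 1 by near: f; exact: one.
have fyb : phi2 (f y) (f b) = 1 by near: f; exact: one.
have fym : phi2 (f y) (f m) = 1 by near: f; exact: one.
have fxb : phi2 (f x) (f b) = 3 by near: f; exact: three.
have fya : phi2 (f y) (f a) = 3 by near: f; exact: three.
have three_neq0 : (3 : F) != 0 by rewrite -(rmorph_nat iota) iota_eq0.
have fam0 : phi2 (f a) (f m) != 0 by rewrite fam oner_eq0.
have fbm0 : phi2 (f b) (f m) != 0 by rewrite fbm oner_eq0.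
have xbE : f x + f b = f a + f m.
  case: (rhombus_diagonals two_neq0 fam0 fxa fxm fba fbm) => // E.
  by move: three_neq0; rewrite -fxb E phi2xx eqxx.
have yaE : f y + f a = f b + f m.
  have fab : phi2 (f a) (f b) = 1 by rewrite phi2C.
  case: (rhombus_diagonals two_neq0 fbm0 fyb fym fab fam) => // E.
  by move: three_neq0; rewrite -fya E phi2xx eqxx.
have -> : f y = 2 *: f m - f x.
  have -> : f y = f b + f m - f a by rewrite -yaE addrK.
  have -> : f b = f a + f m - f x by rewrite -xbE addrC addKr.
  by apply/rowP => i; rewrite !mxE; ring.
transitivity (4 * phi2 (f x) (f m)); first by rewrite /phi2 !mxE; ring.
by rewrite fxm mulr1 rmorph_nat.
Unshelve. all: by end_near. Qed.

(** On a line, the positions [0], [n], [n + 1] and [n + 2] have mutual distances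
[n], [n + 1], [1] and [2] that already determine the image of the last one in
terms of the images of the first and the third. *)
Lemma forced_dist_sqr_nat n : forced_dist (n%:R ^+ 2).
Proof.
suff: forced_dist (n%:R ^+ 2) /\ forced_dist (n.+1%:R ^+ 2) by case.
elim: n => [|n [Dn Dn1]]; first by split; rewrite ?expr0n ?expr1n;
  [exact: forced_dist0|exact: forced_dist1].
split=> // x y xy.
pose N : R := n.+2%:R; have N0 : N != 0 by rewrite pnatr_eq0.
pose pt (k : R) := x + (k / N) *: (y - x).
have dist_pt k l : phi2 (pt k) (pt l) = (k - l) ^+ 2.
  rewrite phi2_line xy rmorphXn /= ratr_nat -/N -mulrBl exprMn exprVn.
  by rewrite mulfVK // sqrf_eq0.
have pt0 : x = pt 0 by rewrite /pt mul0r scale0r addr0.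
have ptN : y = pt N by rewrite /pt divff // scale1r addrC subrK.
rewrite pt0 ptN {xy pt0 ptN}.
have Dpt r k l : forced_dist (r ^+ 2) -> ratr r = l - k ->
    \forall f \near forced, phi2 (f (pt k)) (f (pt l)) = iota (r ^+ 2).
  by move=> Dr rE; apply: Dr; rewrite dist_pt rmorphXn /= rE; ring.
have D1 : forced_dist (1 ^+ 2) by rewrite expr1n; exact: forced_dist1.
have D2 : forced_dist (2 ^+ 2) by rewrite -natrX; exact: forced_dist4.
pose M : R := n%:R.
have NE : N = M + 2 by rewrite /N /M -addn2 natrD.
near=> f.
have f0n : phi2 (f (pt 0)) (f (pt M)) = iota (n%:R ^+ 2).
  by near: f; apply: Dpt; rewrite // ratr_nat subr0.
have f0n1 : phi2 (f (pt 0)) (f (pt (M + 1))) = iota (n.+1%:R ^+ 2).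
  by near: f; apply: Dpt; rewrite // ratr_nat subr0 -addn1 natrD.
have fnn1 : phi2 (f (pt M)) (f (pt (M + 1))) = iota (1 ^+ 2).
  by near: f; apply: Dpt; rewrite // rmorph1; ring.
have fn1n2 : phi2 (f (pt N)) (f (pt (M + 1))) = iota (1 ^+ 2).
  by rewrite phi2C; near: f; apply: Dpt; rewrite // rmorph1 NE; ring.
have fnn2 : phi2 (f (pt M)) (f (pt N)) = iota (2 ^+ 2).
  by near: f; apply: Dpt; rewrite // ratr_nat NE; ring.
have n1E : n.+1%:R = n%:R + 1 :> F by rewrite -addn1 natrD.
have n2E : n.+2%:R = n%:R + 2 :> F by rewrite -addn2 natrD.
have n1 : n%:R + 1 != 0 :> F.
  by rewrite -n1E -(rmorph_nat iota) iota_eq0 pnatr_eq0.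
rewrite !rmorphXn /= ?rmorph_nat ?rmorph1 ?n1E ?n2E
  in f0n f0n1 fnn1 fn1n2 fnn2 *.
have fnE : f (pt M) = f (pt 0)
    + (n%:R / (n%:R + 1)) *: (f (pt (M + 1)) - f (pt 0)).
  apply: collinear => //; rewrite ?f0n ?f0n1 ?fnn1 ?sqrf_eq0 //; by field.
have fn2E : f (pt N) = f (pt M) + 2 *: (f (pt (M + 1)) - f (pt M)).
  apply: collinear; rewrite ?fnn1 ?fnn2 ?fn1n2 ?expr1n ?oner_eq0 //; by ring.
have -> : f (pt N) = f (pt 0)
    + ((n%:R + 2) / (n%:R + 1)) *: (f (pt (M + 1)) - f (pt 0)).
  by rewrite fn2E fnE; apply/rowP => i; rewrite !mxE; field.
by rewrite phi2_line0 f0n1; field.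
Unshelve. all: by end_near. Qed.

(** The hypothesis gives the distance between the images of the two points under
the homothety; forced integer distances transport the homothety itself to
[F^2], where it is then undone. *)
Lemma forced_dist_divide (n : nat) (d : rat) : (0 < n)%N -> 0 < d ->
  forced_dist (n%:R ^+ 2 * d) -> forced_dist d.
Proof.
case: n => // n _ d0 Dnd x y xy.
(* Any positive integer at least sqrt d / 2 would do for the distance to z. *)
pose m := (Num.trunc d).+1.
have dm : d <= 4 * m%:R ^+ 2.
  have : d < m%:R by exact: truncnS_gt.
  have : 1 <= m%:R :> rat by rewrite ler1n.
  nra.
have [||z [xz yz]] := @circles_meet R x y (m%:R ^+ 2) (m%:R ^+ 2).
- by rewrite xy ltr0q.
- rewrite xy addrAC subrr add0r expr2 ler_pM2r ?ltr0q //.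
  have -> : 4 * m%:R ^+ 2 = ratr (4 * m%:R ^+ 2) :> R.
    by rewrite rmorphM rmorphXn /= !ratr_nat.
  by rewrite ler_rat.
pose x' := z + n.+1%:R *: (x - z); pose y' := z + n.+1%:R *: (y - z).
have sqr_dist (k : nat) (p q : 'rV[R]_2) : phi2 p q = k%:R ^+ 2 ->
    \forall f \near forced, phi2 (f p) (f q) = k%:R ^+ 2.
  move=> pq; rewrite -(rmorph_nat iota) -rmorphXn; apply: forced_dist_sqr_nat.
  by rewrite rmorphXn /= ratr_nat.
have m0 : m%:R != 0 :> F by rewrite -(rmorph_nat iota) iota_eq0 pnatr_eq0.
have extend p : phi2 p z = m%:R ^+ 2 -> \forall f \near forced,
    f (z + n.+1%:R *: (p - z)) = f z + n.+1%:R *: (f p - f z).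
  move=> pz; rewrite phi2C in pz; near=> g.
  have gzp : phi2 (g z) (g p) = m%:R ^+ 2 by near: g; exact: sqr_dist.
  have gzp' : phi2 (g z) (g (z + n.+1%:R *: (p - z))) = (n.+1 * m)%:R ^+ 2.
    near: g; apply: sqr_dist.
    by rewrite phi2_line0 pz natrM; ring.
  have gpp' : phi2 (g (z + n.+1%:R *: (p - z))) (g p) = (n * m)%:R ^+ 2.
    near: g; apply: sqr_dist.
    by rewrite phi2_line1 pz natrM -(natr1 n); ring.
  apply: collinear; rewrite ?gzp ?gzp' ?gpp' ?sqrf_eq0 // natrM.
    by ring.
  by rewrite -(natr1 n); ring.
near=> f.
have fx'y' : phi2 (f x') (f y') = iota (n.+1%:R ^+ 2 * d).
  near: f; apply: Dnd; rewrite phi2_homothety xy.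
  by rewrite rmorphM rmorphXn /= ratr_nat.
have fx'E : f x' = f z + n.+1%:R *: (f x - f z) by near: f; exact: extend.
have fy'E : f y' = f z + n.+1%:R *: (f y - f z) by near: f; exact: extend.
move: fx'y'; rewrite fx'E fy'E phi2_homothety rmorphM rmorphXn /= rmorph_nat.
apply: mulfI; rewrite sqrf_eq0.
by rewrite -(rmorph_nat iota) iota_eq0 pnatr_eq0.
Unshelve. all: by end_near. Qed.

(** * All rational distances *)

Lemma forced_dist_sqr (q : rat) : 0 < q -> forced_dist (q ^+ 2).
Proof.
move=> q0; apply: (@forced_dist_divide `|denq q|).
- by rewrite absz_gt0 denq_neq0.
- by rewrite exprn_gt0.
rewrite -exprMn (_ : _ * q = `|numq q|%:R); first exact: forced_dist_sqr_nat.
rewrite -[q in _ * q]divq_num_den !pmulrn !abszE.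
rewrite (gtr0_norm (denq_gt0 q)) gtr0_norm ?numq_gt0 //.
by rewrite mulrC divfK // intr_eq0 denq_neq0.
Qed.

Lemma forced_dist_pos (r : rat) : 0 < r -> forced_dist r.
Proof.
move=> r0; have [->|r1] := eqVneq r 1; first exact: forced_dist1.
(* c = r / (1 + r) is a positive rational with c ^+ 2 < r; b is nonzero since
   r is not 1. *)
pose a := (r + 1) / 4; pose b := `|r - 1| / 2; pose c := r / (1 + r).
have b2 : b ^+ 2 = (r - 1) ^+ 2 / 4.
  by rewrite /b expr_div_n real_normK ?num_real.
have rE : r = 4 * a ^+ 2 - b ^+ 2 by rewrite b2 /a; field.
have c0 : 0 < c by rewrite divr_gt0 // addr_gt0.
have c2r : c ^+ 2 < r.
  have cE : c * (1 + r) = r by rewrite /c divfK // gt_eqF // addr_gt0.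
  nra.
have b0 : 0 < b by rewrite divr_gt0 // normr_gt0 subr_eq0.
have a0 : 0 < a by rewrite divr_gt0 // addr_gt0.
rewrite rE; apply: (forced_dist_rhombus _ _ (forced_dist_sqr c0)).
- exact: forced_dist_sqr.
- exact: forced_dist_sqr.
- by rewrite exprn_gt0 //=; lra.
- by rewrite -rE exprn_gt0 //=; lra.
- by rewrite -rE lt_eqF.
Qed.

End ForcedDistances.

(** In characteristic [0] the integers embed in [F], and so do fractions. *)
Lemma ratr_morphism (F : fieldType) : [pchar F] =i pred0 ->
  exists iota : {rmorphism rat -> F}, iota =1 ratr.
Proof.
move=> /pcharf0P charF0.
have int_eq0 (z : int) : (z%:~R == 0 :> F) = (z == 0).
  by case: (intP z) => [|n|n]; rewrite ?rmorphN ?oppr_eq0 //= -?pmulrn charF0.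
have den0 q : (denq q)%:~R != 0 :> F by rewrite int_eq0 denq_neq0.
(* ratr is defined from the reduced form of a fraction, whereas sums and
   products come with unreduced denominators. *)
have ratr_frac (q : rat) (u v : int) : v != 0 -> q * v%:~R = u%:~R ->
    ratr q = u%:~R / v%:~R :> F.
  move=> v0 quv; rewrite /ratr; apply/eqP; rewrite eqr_div ?int_eq0 //.
  rewrite -!intrM; apply/eqP; congr (_%:~R).
  apply: (@intr_inj rat); rewrite !intrM -quv.
  by rewrite -{2}[q]divq_num_den; field; rewrite intr_eq0 denq_neq0.
have ratD : zmod_morphism (@ratr F).
  move=> p q; rewrite (@ratr_frac _ (numq p * denq q - numq q * denq p)
                                    (denq p * denq q)).
  - by rewrite /ratr rmorphB !rmorphM /=; field; rewrite !den0.
  - by rewrite mulf_neq0 ?denq_neq0.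
  - rewrite -{1}[p]divq_num_den -{1}[q]divq_num_den rmorphB !rmorphM /=.
    by field; rewrite !intr_eq0 !denq_neq0.
have ratM : monoid_morphism (@ratr F).
  split=> [|p q]; first by rewrite (ratr_nat _ 1).
  rewrite (@ratr_frac _ (numq p * numq q) (denq p * denq q)).
  - by rewrite /ratr !rmorphM /=; field; rewrite !den0.
  - by rewrite mulf_neq0 ?denq_neq0.
  - rewrite -{1}[p]divq_num_den -{1}[q]divq_num_den !rmorphM /=.
    by field; rewrite !intr_eq0 !denq_neq0.
pose iota : {rmorphism rat -> F} := HB.pack (@ratr F)
  (GRing.isZmodMorphism.Build rat F (@ratr F) ratD)
  (GRing.isMonoidMorphism.Build rat F (@ratr F) ratM).
by exists iota.
Qed.

Theorem theorem3 (R : realType) (F : fieldType) (charF0 : [pchar F] =i pred0)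
    (x y : 'rV[R]_2) (r : rat) (xy_r : edist x y ^+ 2 = ratr r) :
  exists S : set 'rV[R]_2, finite_set S /\
    exists (xS : x \in S) (yS : y \in S),
      forall f : S -> 'rV[F]_2, preserves_unit_distance f ->
        phi2 (f (exist _ x xS)) (f (exist _ y yS)) = ratr r.
Proof.
have [iota iotaE] := ratr_morphism charF0.
have xy : phi2 x y = ratr r.
  by rewrite -xy_r sqr_sqrtr // addr_ge0 ?sqr_ge0.
have [s sP] : \forall f \near @forced R F, phi2 (f x) (f y) = iota r.
  have [r0|r0|r0] := ltgtP r 0.
  - have : (0 : R) <= ratr r by rewrite -xy addr_ge0 ?sqr_ge0.
    by rewrite ler0q leNgt r0.
  - exact: forced_dist_pos.
  - by subst r; exact: forced_dist0.
pose S := [set` [:: x, y & s]].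
have xS : x \in S by rewrite inE /S /= inE eqxx.
have yS : y \in S by rewrite inE /S /= !inE eqxx orbT.
exists S; split; first exact: finite_seq.
exists xS, yS => f f1; rewrite -iotaE.
(* The filter speaks of total maps, so f is extended by an arbitrary value. *)
pose g p := if insub p is Some q then f q else 0 : 'rV[F]_2.
have gE p (pS : p \in S) : g p = f (exist _ p pS).
  by rewrite /g insubT.
have inS p : p \in s -> p \in S by move=> ps; rewrite inE /S /= !inE ps !orbT.
rewrite -!gE; apply: sP => p q ps qs pq.
by rewrite (gE p (inS p ps)) (gE q (inS q qs)); apply: f1; apply/edist1E.
Qed.
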